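(* Let $T$ be a tree of order $n$ and let $k\geq 3$ be an integer such that $k<\mathrm{rad}(T)$. Then $$\gamma_{B_k}(T)\leq \left\lceil \frac{k+2}{k+1}\cdot\frac{n}{3}\right\rceil.$$
   Context: $d(u,v)$ denotes the distance in the graph; $\mathrm{rad}(T)$ is the radius (minimum eccentricity of a vertex). For a connected graph $G$ and an integer $k\ge 1$, a function $f\colon V(G)\to\{0,1,\dots,k\}$ is a dominating $k$-broadcast on $G$ if for every $u\in V(G)$ there is a vertex $v$ with $f(v)\geq 1$ and $d(u,v)\leq f(v)$. Its cost is $\omega(f)=\sum_{u\in V(G)}f(u)$, and the dominating $k$-broadcast number $\gamma_{B_k}(G)$ is the minimum cost of a dominating $k$-broadcast on $G$. *)

(* Defs.v *)
From mathcomp Require Import all_boot.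
Set Implicit Arguments. Unset Strict Implicit. Unset Printing Implicit Defensive.

Section Graph.
Variables (T : finType) (e : rel T).

Definition simple_graph : Prop := symmetric e /\ irreflexive e.

Definition connected_graph : Prop := forall x y : T, connect e x y.

Definition acyclic : Prop :=
  ~ exists (v0 : T) (p : seq T),
      [/\ 2 <= size p, uniq (v0 :: p), path e v0 p & e (last v0 p) v0].

Definition is_tree : Prop := simple_graph /\ connected_graph /\ acyclic.

Fixpoint ball (k : nat) (u : T) : {set T} :=
  if k is k'.+1 then
    ball k' u :|: [set y | [exists x in ball k' u, e x y]]
  else [set u].

(* d(u,v): least k with v in ball k u (for connected graphs k < #|T|). *)
Definition dist (u v : T) : nat :=
  find (fun k => v \in ball k u) (iota 0 #|T|).

Definition ecc (v : T) : nat := \max_(u : T) dist u v.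

Definition rad : nat := \big[minn/#|T|]_(v : T) ecc v.

Definition dom_broadcast (k : nat) (f : {ffun T -> 'I_k.+1}) : bool :=
  [forall u : T, exists v : T, (1 <= f v) && (dist u v <= f v)].

Definition bcost (k : nat) (f : {ffun T -> 'I_k.+1}) : nat :=
  \sum_(v : T) (f v : nat).

(* gamma_{B_k}: minimum cost of a dominating k-broadcast
   (default k * #|T| if none exists, which never happens for
   connected graphs with k >= 1). *)
Definition gammaB (k : nat) : nat :=
  \big[minn/(k * #|T|)]_(f : {ffun T -> 'I_k.+1} | dom_broadcast f) bcost f.

End Graph.

Definition ceil_div (a b : nat) : nat := (a + b - 1) %/ b.

(* Main.v *)
Require Import Defs.
From mathcomp Require Import all_boot.
From mathcomp Require Import zify.
Set Implicit Arguments. Unset Strict Implicit. Unset Printing Implicit Defensive.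

(* Only a rooted spanning tree is needed, by induction on its order.  If a branch
   of order m fits in a ball of radius R <= k with 3(k+1)R <= (k+2)m, cut it off
   and pay R.  If no such branch exists, every branch is incompressible, and a
   recursion on the height h and the diameter M gives 2m > 2h + M for branches
   and 2m >= 3M - 2 for the whole tree.  If M <= 2k, a single ball at the centre
   is then cheap enough.  Otherwise take a lowest vertex v where two child
   branches make up a path of length > 2k.  One of these has height at least k,
   while incompressibility forces such a branch to have height exactly k, with
   (k, order) = (3, 7) or (5, 10), and its deepest vertices to lie in one ball of
   radius 1.  Both branches are then cut off together, paying for a ball of
   radius k at v and at most one ball of radius 1 in each. *)

(* [Graft t s] is [t] with [s] attached as one more child of its root: removing
   a branch then stays within structural recursion. *)
Inductive rtree (T : Type) := One of T | Graft of rtree T & rtree T.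

(** * Rooted trees: order, height and diameter *)

Section RootedTrees.
Variables (T : eqType) (e : rel T).
Implicit Types t s : rtree T.

Fixpoint troot t : T :=
  match t with One x => x | Graft t1 _ => troot t1 end.

Fixpoint labels t : seq T :=
  match t with One x => [:: x] | Graft t1 s => labels t1 ++ labels s end.

Definition tsize t := size (labels t).

Fixpoint ht t : nat :=
  match t with One _ => 0 | Graft t1 s => maxn (ht t1) (ht s).+1 end.

Fixpoint dia t : nat :=
  match t with
  | One _ => 0
  | Graft t1 s => maxn (maxn (dia t1) (dia s)) (ht t1 + (ht s).+1)
  end.

Lemma tsize_Graft t s : tsize (Graft t s) = tsize t + tsize s.
Proof. exact: size_cat. Qed.

Lemma tsize_gt0 t : 0 < tsize t.
Proof. by elim: t => // t IHt s _; rewrite tsize_Graft addn_gt0 IHt. Qed.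

Lemma ht0_tsize t : ht t = 0 -> tsize t = 1.
Proof. by case: t => //= t s; lia. Qed.

Lemma ht_le_dia t : ht t <= dia t.
Proof. elim: t => //= t IHt s IHs; lia. Qed.

Lemma dia_le_double_ht t : dia t <= 2 * ht t.
Proof. elim: t => //= t IHt s IHs; lia. Qed.

Fixpoint wf t : bool :=
  match t with
  | One _ => true
  | Graft t1 s => [&& wf t1, wf s & e (troot t1) (troot s)]
  end.

End RootedTrees.

(** * Lower bounds on the order of incompressible branches *)

Section Irreducible.
Variables (T : eqType) (e : rel T) (k : nat).
Implicit Types t s : rtree T.

Definition incompressible s : Prop :=
  forall R, 0 < R <= k -> dia s <= 2 * R ->
    (k + 2) * tsize s < 3 * (k + 1) * R.

Fixpoint irreducible t : Prop :=
  match t with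
  | One _ => True
  | Graft t1 s => [/\ irreducible t1, irreducible s & incompressible s]
  end.

(** As [3(k+1)R = 3(k+2)R - 3R], the order is below [3R - 3R/(k+2)]; the clauses round this. *)
Lemma incompressible_tsize s R :
    incompressible s -> 0 < R <= k -> dia s <= 2 * R ->
  [/\ tsize s < 3 * R,
      k + 2 <= 3 * R -> tsize s + 2 <= 3 * R
    & 2 * (k + 2) <= 3 * R -> tsize s + 3 <= 3 * R].
Proof. by move=> inc hR hd; have := inc R hR hd; split; nia. Qed.

Lemma incompressible_slack s :
    incompressible s -> dia s <= 2 * k ->
    2 * ht s + dia s <= 2 * tsize s ->
    (2 * tsize s = 2 * ht s + dia s -> dia s = ht s) ->
  2 * ht s + dia s < 2 * tsize s.
Proof.
move=> inc hd h1 h2; have m0 := tsize_gt0 s.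
rewrite ltn_neqAle h1 andbT; apply/eqP => E.
have E2 := h2 (esym E).
(* Equality forces [2 * tsize s = 3 * ht s]; the height is then even and half of it is a radius with
   [3R = tsize s]. *)
have [||//] := incompressible_tsize (R := (ht s)./2) inc; lia.
Qed.

(** The equality clause is carried along so that [incompressible_slack] can make the bound strict on
    each branch. *)
Lemma irreducible_tsize t :
    irreducible t -> dia t <= 2 * k ->
  2 * ht t + dia t <= 2 * tsize t /\
  (2 * tsize t = 2 * ht t + dia t -> dia t = ht t).
Proof.
elim: t => [x _ _ //|t IHt s IHs] [it is_ inc] hd.
have [||t1 t2] := IHt; [by []|by move: hd => /=; lia|].
have hds : dia s <= 2 * k by move: hd => /=; lia.
have [s1 s2] := IHs is_ hds.
have s3 := incompressible_slack inc hds s1 s2.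
have := ht_le_dia t; have := dia_le_double_ht t.
have := ht_le_dia s; have := dia_le_double_ht s.
have := @ht0_tsize _ t.
have := tsize_gt0 t; have := tsize_gt0 s.
rewrite tsize_Graft /=; move: hd => /=; lia.
Qed.

Lemma branch_tsize s :
    irreducible s -> incompressible s -> dia s <= 2 * k ->
  2 * ht s + dia s < 2 * tsize s.
Proof.
move=> is_ inc hd; have [h1 h2] := irreducible_tsize is_ hd.
exact: incompressible_slack.
Qed.

(** A path through the root joins heights [h] and [h' + 1], where the two sides satisfy [2m >= 3h]
    and [2m' > 3h']. *)
Lemma irreducible_tsize_dia t :
  irreducible t -> dia t <= 2 * k -> 3 * dia t <= 2 * tsize t + 2.
Proof.
elim: t => [//|t IHt s IHs] [it is_ inc] hd.
have hdt : dia t <= 2 * k by move: hd => /=; lia.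
have hds : dia s <= 2 * k by move: hd => /=; lia.
have := IHt it hdt; have := IHs is_ hds.
have [h1 _] := irreducible_tsize it hdt.
have h2 := branch_tsize is_ inc hds.
have := ht_le_dia t; have := ht_le_dia s.
by rewrite tsize_Graft /=; lia.
Qed.

(** Grafting order is arbitrary; this brings a tallest child to the outermost graft. *)
Lemma tallest_child t :
    0 < ht t ->
  exists t0 s,
    let g := Graft t0 s in
    [/\ ht t = (ht s).+1, ht t0 <= ht t, dia t = dia g
      & irreducible t -> irreducible g] /\
    [/\ troot t0 = troot t, perm_eq (labels t) (labels g) & wf e t -> wf e g].
Proof.
elim: t => [//|t IHt s _] /= h0.
have [hlt|hle] := ltnP (ht s).+1 (ht t); last first.
  by exists t, s; split; split=> //; lia.
have [|t0 [s1 /= [[h1 h2 d0 i0] [r0 p0 w0]]]] := IHt; first by lia.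
exists (Graft t0 s), s1; split; split=> //=.
- lia.
- lia.
- by case=> /i0[? ? ?] ? ?.
- by rewrite perm_sym perm_catAC perm_cat2r perm_sym.
- by case/and3P=> /w0/and3P[-> -> e1] -> e2; rewrite r0 e2 -r0 e1.
Qed.

(** For [R] half the diameter rounded up, [3 * dia s - 2 <= 2 * tsize s <= 6R - 4]: impossible for
    even diameter, a single value for odd. *)
Lemma branch_tsize_dia s :
    irreducible s -> incompressible s -> dia s <= 2 * k ->
    k + 1 < 3 * uphalf (dia s) ->
  [/\ odd (dia s), 2 * tsize s + 1 = 3 * dia s
    & 3 * (dia s + 1) < 4 * (k + 2)].
Proof.
move=> is_ inc hd hR; have h1 := irreducible_tsize_dia is_ hd.
have [||h2 h3 h4] := incompressible_tsize (R := uphalf (dia s)) inc; [lia|lia|].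
have {}h3 : tsize s + 2 <= 3 * uphalf (dia s) by apply: h3; lia.
have od : odd (dia s) by lia.
split=> //; first by lia.
by rewrite ltnNge; apply/negP => h; have := h4; lia.
Qed.

End Irreducible.

(** * Balls, centres and deepest vertices *)

Section Balls.
Variables (T : finType) (e : rel T).
Hypothesis e_sym : symmetric e.
Implicit Types (t s : rtree T) (x y z : T).

Lemma ball_self r x : x \in ball e r x.
Proof. by elim: r => [|r IHr] /=; rewrite !inE ?IHr. Qed.

Lemma ball_step r x y z : y \in ball e r x -> e y z -> z \in ball e r.+1 x.
Proof.
by move=> yx yz; rewrite /= !inE; apply/orP; right; apply/existsP; exists y; rewrite yx.
Qed.

Lemma ball_trans a b x y z :
  y \in ball e a x -> z \in ball e b y -> z \in ball e (a + b) x.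
Proof.
move=> yx; elim: b z => [|b IHb] z /=; first by rewrite inE addn0 => /eqP->.
rewrite addnS !inE => /orP[/IHb->//|/existsP[u /andP[/IHb ux uz]]].
by apply/orP; right; apply/existsP; exists u; rewrite ux.
Qed.

Lemma ball1 x y : e x y -> y \in ball e 1 x.
Proof. exact: ball_step (ball_self 0 x). Qed.

Lemma ball_sym r x y : y \in ball e r x -> x \in ball e r y.
Proof.
elim: r x y => [|r IHr] x y /=; first by rewrite !inE eq_sym.
rewrite !inE => /orP[/IHr->//|/existsP[u /andP[/IHr ux uy]]].
have yu : u \in ball e 1 y by apply: ball1; rewrite e_sym.
by have := ball_trans yu ux; rewrite add1n /= !inE.
Qed.

Lemma ball_mono a b x y : a <= b -> y \in ball e a x -> y \in ball e b x.
Proof. by move=> /subnKC <- yx; apply: ball_trans yx (ball_self _ _). Qed.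

Lemma dist_ball r x y : y \in ball e r x -> dist e x y <= r.
Proof.
move=> yx; rewrite /dist; set p := (p in find p _).
(* [find] never exceeds its default [#|T|], which settles large radii. *)
have [rT|] := ltnP r #|T|; last first.
  by apply: leq_trans; rewrite -[leqRHS](size_iota 0) find_size.
rewrite leqNgt; apply/negP => /(before_find 0).
by rewrite nth_iota // /p add0n yx.
Qed.

Lemma ball_ht t y : wf e t -> y \in labels t -> y \in ball e (ht t) (troot t).
Proof.
elim: t y => [x|t IHt s IHs] y /=; first by rewrite !inE.
case/and3P=> wt ws ets; rewrite mem_cat => /orP[/(IHt _ wt)|/(IHs _ ws) ys].
  by apply: ball_mono; lia.
apply: ball_mono (ball_trans (ball1 ets) ys); lia.
Qed.

(** Descend [ht t - R] levels through tallest children. The part left behind at a level has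
    [ht t0 + ht t <= dia t <= 2R], hence lies within [R] of the end of the descent. *)
Lemma center_exists t R :
    wf e t -> dia t <= 2 * R ->
  exists2 w, w \in ball e (ht t - R) (troot t) &
    forall y, y \in labels t -> y \in ball e R w.
Proof.
move En : (tsize t) => n; elim/ltn_ind: n t En => n IHn t En wt hd.
have [hR|hR] := leqP (ht t) R.
  exists (troot t); first exact: ball_self.
  by move=> y /(ball_ht wt); apply: ball_mono.
have [|t0 [s /= [[h1 h2 d0 _] [r0 p0 w0]]]] := @tallest_child _ e 0 t; first by lia.
have /and3P[wt0 ws es] := w0 wt.
have ms : tsize s < n.
  by rewrite -En /tsize (perm_size p0) size_cat -[ltnLHS]add0n ltn_add2r tsize_gt0.
have [|w wr wc] := IHn _ ms s erefl ws; first by lia.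
rewrite -r0; exists w.
  by apply: ball_mono (ball_trans (ball1 es) wr); lia.
move=> y; rewrite (perm_mem p0) mem_cat => /orP[/(ball_ht wt0) yt|/wc//].
have := ball_trans (ball_sym (ball_trans (ball1 es) wr)) yt.
by apply: ball_mono; lia.
Qed.

(** In a branch of height [k], the ball of radius [k] around the parent of its root reaches all but
    the last level; one more unit must cover that level. *)
Definition tipped t : Prop :=
  exists p, forall y, y \in labels t ->
    y \in ball e (ht t).-1 (troot t) \/ y \in ball e 1 p.

Lemma tipped_graft t t0 s :
    wf e (Graft t0 s) -> troot t0 = troot t ->
    perm_eq (labels t) (labels (Graft t0 s)) ->
    ht t = (ht s).+1 -> ht t0 < ht t -> 0 < ht s -> tipped s ->
  tipped t.
Proof.
move=> /= /and3P[wt0 ws es] r0 p0 h1 h2 h3 [p ps]; exists p => y.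
rewrite (perm_mem p0) mem_cat -r0 => /orP[/(ball_ht wt0) yt|/ps[ys|]]; last by right.
  by left; apply: ball_mono yt; lia.
by left; apply: ball_mono (ball_trans (ball1 es) ys); lia.
Qed.

Lemma tipped_dia_le3 t : wf e t -> 0 < ht t -> dia t <= 3 -> tipped t.
Proof.
move En : (ht t) => n; elim: n t En => [|n IHn] // t En wt _ hd.
case: n IHn En => [_ E1|n IHn En].
  by exists (troot t) => y /(ball_ht wt); rewrite E1; right.
have [|t0 [s /= [[h1 h2 d0 _] [r0 p0 w0]]]] := @tallest_child _ e 0 t; first by lia.
have wg := w0 wt; have /and3P[_ ws _] := wg.
apply: (tipped_graft wg r0 p0 h1); [lia|lia|].
by apply: IHn; lia.
Qed.

(** The exact order from [branch_tsize_dia] is too small for a longest path that avoids the root or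
    ends there. The summand [(ht t0 == 1)] appears because height 1 already takes two vertices. *)
Lemma branch_tallest_child k s :
    wf e s -> irreducible k s -> incompressible k s -> dia s <= 2 * k ->
    k + 1 < 3 * uphalf (dia s) ->
  exists t0 s1,
    [/\ wf e (Graft t0 s1), troot t0 = troot s,
        perm_eq (labels s) (labels (Graft t0 s1)),
        irreducible k s1 & incompressible k s1] /\
    [/\ ht s = (ht s1).+1, dia s = ht s + ht t0, dia s1 < dia s,
        0 < ht t0 & 2 * tsize s1 + (3 * ht t0 + (ht t0 == 1)) < 3 * dia s].
Proof.
move=> ws is_ inc hd hR; have hs := ht_le_dia s; have ds := dia_le_double_ht s.
have [_ ms _] := branch_tsize_dia is_ inc hd hR.
have [|t0 [s1 /= [[h1 h2 d0 i0] [r0 p0 w0]]]] := @tallest_child _ e k s; first by lia.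
have [it0 is1 inc1] := i0 is_.
have m0 : tsize s = tsize t0 + tsize s1 by rewrite /tsize (perm_size p0) size_cat.
have hd1 : dia s1 <= 2 * k by lia.
have [|t0m _] := irreducible_tsize it0; first by lia.
have s1m := branch_tsize is1 inc1 hd1.
have s1m' := irreducible_tsize_dia is1 hd1.
have ht1 := ht_le_dia s1; have ht0 := ht_le_dia t0.
have dt0 := dia_le_double_ht t0; have mt0 := tsize_gt0 t0.
exists t0, s1; split; split=> //; first exact: w0.
- clear hR; lia.
- clear hR; lia.
- clear hR; lia.
- clear hR; lia.
Qed.

(* Counting pins down the two tallest children of a tall incompressible branch
   and of its tallest child; the resulting parities survive only for [k = 3]
   and [k = 5]. *)
Lemma tall_branch k s :
    2 < k -> wf e s -> irreducible k s -> incompressible k s ->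
    dia s <= 2 * k -> k <= ht s ->
  [/\ ht s = k, (k, tsize s) \in [:: (3, 7); (5, 10)] & tipped s].
Proof.
move=> k3 ws is_ inc hd hk; have hs := ht_le_dia s.
have hR : k + 1 < 3 * uphalf (dia s) by lia.
have [od ms1 ms2] := branch_tsize_dia is_ inc hd hR.
have [t0 [s1 [[wg r0 p0 is1 inc1] [h1 d1 d1s h0 m1]]]] :=
  branch_tallest_child ws is_ inc hd hR.
have hd1 : dia s1 <= 2 * k by clear -hd d1s; lia.
have ws1 : wf e s1 by case/and3P: wg.
have s1m := branch_tsize is1 inc1 hd1; have hs1 := ht_le_dia s1.
have ub1 : dia s1 <= ht s by clear -h1 s1m m1 d1; lia.
(* An even diameter would allow the radius [dia s1 / 2], whose bound on the order contradicts [s1m]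
   and [ub1]. *)
have od1 : odd (dia s1).
  apply/negPn/negP => od1.
  have [||hlt _ _] := incompressible_tsize (R := (dia s1)./2) inc1.
  - clear -od1 h1 hk k3 hs1 hd1; lia.
  - clear -od1; lia.
  by clear -od1 hlt s1m ub1 h1; lia.
have hR1 : k + 1 < 3 * uphalf (dia s1) by clear -od1 h1 hk k3 hs1; lia.
have [_ ms3 _] := branch_tsize_dia is1 inc1 hd1 hR1.
have {hs1} d1h : dia s1 = ht s by clear -ms3 s1m ub1 h1; lia.
have [t1 [s2 [[wg1 r2 p2 is2 inc2] [h2 d2 d2s h3 m2]]]] :=
  branch_tallest_child ws1 is1 inc1 hd1 hR1.
have ht1_1 : ht t1 = 1 by clear -d2 d1h h1; lia.
have hd2 : dia s2 <= 2 * k by clear -hd1 d2s; lia.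
have ws2 : wf e s2 by case/and3P: wg1.
have s2m := branch_tsize is2 inc2 hd2; have hs2 := ht_le_dia s2.
rewrite ht1_1 eqxx in m2 d2.
have d3 : dia s2 = ht s2 by clear -m2 s2m hs2 d2 h2; lia.
have small : 3 * uphalf (dia s2) <= k + 1.
  rewrite leqNgt; apply/negP => h.
  by have [_ ms4 _] := branch_tsize_dia is2 inc2 hd2 h; clear -ms4 m2 s2m d3 d2 h2; lia.
(* As [ht s] is odd and [dia s2 = ht s - 2], [small] reads [3 * (ht s - 1) <= 2 * (k + 1)], while
   [k <= ht s]. *)
have hk5 : ht s = k /\ (k = 3 \/ k = 5).
  by clear -small d3 h2 h1 hk k3 od1 d1h; lia.
have h02 : ht t0 = 2.
  by clear -hk5 od d1 ms1 ms2 h0; lia.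
case: hk5 => hsk kE; split=> //.
- by rewrite !inE !xpair_eqE; clear -ms1 d1 hsk kE h02; lia.
(* The side parts [t0] and [t1], of heights 2 and 1, stay above the last level, and [s2] has
   diameter 1 or 3. *)
- apply: (tipped_graft wg r0 p0 h1); [clear -h02 hsk k3; lia|clear -h1 hsk k3; lia|].
  apply: (tipped_graft wg1 r2 p2 h2); [clear -ht1_1 h1 hsk k3; lia|clear -h1 h2 hsk k3; lia|].
  by apply: tipped_dia_le3 => //; clear -d3 h2 h1 hsk kE; lia.
Qed.

End Balls.

(** * Partial broadcasts and reductions *)

Section Broadcasts.
Variables (T : finType) (e : rel T) (k : nat).
Hypothesis e_sym : symmetric e.
Implicit Types (t s : rtree T) (S : seq T).

Definition dominable S (c : nat) : bool :=
  [exists f : {ffun T -> 'I_k.+1}, (bcost f <= c) &&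
    all (fun u => [exists v, (1 <= f v) && (dist e u v <= f v)]) S].

Lemma dominable_ball w R S :
  0 < R <= k -> (forall y, y \in S -> y \in ball e R w) -> dominable S R.
Proof.
move=> /andP[R0 Rk] cov.
pose f : {ffun T -> 'I_k.+1} := [ffun x => if x == w then inord R else ord0].
have fw : f w = R :> nat by rewrite ffunE eqxx inordK.
apply/existsP; exists f; apply/andP; split.
  rewrite /bcost (bigD1 w) //= fw big1 ?addn0 // => x xw.
  by rewrite ffunE (negPf xw).
apply/allP => u /cov uw; apply/existsP; exists w.
by rewrite fw R0 dist_ball // ball_sym.
Qed.

(** The pointwise maximum costs at most the sum and, unlike the sum, keeps values within [k]. *)
Lemma dominable_cat S1 S2 c1 c2 :
  dominable S1 c1 -> dominable S2 c2 -> dominable (S1 ++ S2) (c1 + c2).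
Proof.
move=> /existsP[f /andP[fc fd]] /existsP[g /andP[gc gd]].
pose m : {ffun T -> 'I_k.+1} := [ffun x => if f x <= g x then g x else f x].
have mf x : f x <= m x by rewrite ffunE; case: ifP.
have mg x : g x <= m x by rewrite ffunE; case: ifPn => //; rewrite -ltnNge => /ltnW.
apply/existsP; exists m; apply/andP; split.
  apply: leq_trans (leq_add fc gc); rewrite /bcost -big_split /=.
  by apply: leq_sum => x _; rewrite ffunE; case: ifP => _; [apply: leq_addl|apply: leq_addr].
rewrite all_cat; apply/andP; split; apply/allP => u.
- move/(allP fd)=> /existsP[v /andP[v1 v2]]; apply/existsP; exists v.
  by rewrite (leq_trans v1 (mf v)) (leq_trans v2 (mf v)).
- move/(allP gd)=> /existsP[v /andP[v1 v2]]; apply/existsP; exists v.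
  by rewrite (leq_trans v1 (mg v)) (leq_trans v2 (mg v)).
Qed.

Lemma dominable_sub S1 S2 c1 c2 :
  {subset S1 <= S2} -> c2 <= c1 -> dominable S2 c2 -> dominable S1 c1.
Proof.
move=> sub lec /existsP[f /andP[fc /allP fd]]; apply/existsP; exists f.
by rewrite (leq_trans fc lec); apply/allP => u /sub /fd.
Qed.

Lemma gammaB_dominable c : dominable (enum T) c -> gammaB e k <= c.
Proof.
move=> /existsP[f /andP[fc /allP fd]].
have {}fd : dom_broadcast e f by apply/forallP => u; apply: fd; rewrite mem_enum.
apply: leq_trans fc; rewrite /gammaB -big_filter.
have : f \in [seq g <- index_enum _ | dom_broadcast e g].
  by rewrite mem_filter fd mem_index_enum.
elim: filter => // g l IHl; rewrite inE big_cons.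
by case/predU1P=> [<-|/IHl le_l]; rewrite geq_min ?leqnn // le_l orbT.
Qed.

(** Each removed vertex pays at most [(k+2)/(3(k+1))]. Keeping the root lets [t'] replace [t] inside
    a larger tree. *)
Definition reducible t : Prop :=
  exists t' S j,
    [/\ wf e t' /\ troot t' = troot t, {subset labels t <= labels t' ++ S},
        tsize t' < tsize t, dominable S j
      & 3 * (k + 1) * j <= (k + 2) * (tsize t - tsize t')].

Lemma reducible_Graftl t s : wf e (Graft t s) -> reducible t -> reducible (Graft t s).
Proof.
move=> /= /and3P[wt ws es] [t' [S [j [[wt' r'] sub lt dom cost]]]].
exists (Graft t' s), S, j; split=> //=.
- by rewrite wt' ws r' es.
- move=> x; rewrite !mem_cat => /orP[/sub|->]; last by rewrite orbT.
  by rewrite mem_cat => /orP[->|->]; rewrite ?orbT.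
- by rewrite !tsize_Graft ltn_add2r.
- by rewrite !tsize_Graft subnDr.
Qed.

Lemma reducible_Graftr t s : wf e (Graft t s) -> reducible s -> reducible (Graft t s).
Proof.
move=> /= /and3P[wt ws es] [s' [S [j [[ws' r'] sub lt dom cost]]]].
exists (Graft t s'), S, j; split=> //=.
- by rewrite wt ws' r' es.
- move=> x; rewrite !mem_cat => /orP[->//|/sub].
  by rewrite mem_cat => /orP[->|->]; rewrite ?orbT.
- by rewrite !tsize_Graft ltn_add2l.
- by rewrite !tsize_Graft subnDl.
Qed.

Lemma not_reducible_irreducible t : wf e t -> ~ reducible t -> irreducible k t.
Proof.
elim: t => [//|t IHt s IHs] wg nred; have /= /and3P[wt ws es] := wg.
split.
- by apply: IHt => // /(reducible_Graftl wg).
- by apply: IHs => // /(reducible_Graftr wg).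
move=> R hR hd; rewrite ltnNge; apply/negP => cost; apply: nred.
have [w _ cov] := center_exists e_sym ws hd.
exists t, (labels s), R; split=> //.
- by rewrite tsize_Graft -[ltnLHS]addn0 ltn_add2l tsize_gt0.
- exact: dominable_ball cov.
- by rewrite tsize_Graft addKn.
Qed.

(* What the ball of radius [k] around the parent [v] of a branch misses costs
   at most one more unit. *)
Lemma branch_residue v s :
    2 < k -> wf e s -> e v (troot s) -> irreducible k s -> incompressible k s ->
    dia s <= 2 * k ->
  exists S x,
    [/\ forall y, y \in labels s -> y \in ball e k v \/ y \in S, dominable S x
      & (x = 0 /\ ht s < k) \/
        [/\ x = 1, ht s = k & (k, tsize s) \in [:: (3, 7); (5, 10)]]].
Proof.
move=> k3 ws es is_ inc hd; have [hlt|hle] := ltnP (ht s) k.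
  exists [::], 0; split; last by left.
  - move=> y /(ball_ht ws) ys; left.
    by apply: ball_mono (ball_trans (ball1 es) ys); lia.
  - apply/existsP; exists [ffun=> ord0]; rewrite /= andbT /bcost big1 // => x _.
    by rewrite ffunE.
have [hk km [p tip]] := tall_branch k3 ws is_ inc hd hle.
exists [seq y <- labels s | y \in ball e 1 p], 1; split; last by right.
- move=> y ys; rewrite mem_filter ys andbT; have [yp|->] := tip y ys; last by right.
  by left; apply: ball_mono (ball_trans (ball1 es) yp); lia.
- apply: (@dominable_ball p); first by lia.
  by move=> y; rewrite mem_filter => /andP[].
Qed.

Lemma not_reducible_dia t :
  2 < k -> wf e t -> ~ reducible t -> dia t <= 2 * k.
Proof.
move=> k3; elim: t => [//|t IHt s IHs] wg nred; have /= /and3P[wt ws es] := wg.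
have hdt : dia t <= 2 * k by apply: IHt => // /(reducible_Graftl wg).
have hds : dia s <= 2 * k by apply: IHs => // /(reducible_Graftr wg).
rewrite !geq_max hdt hds leqNgt; apply/negP => hts.
have [it is_ inc] := not_reducible_irreducible wg nred.
have [S [x [Scov Sdom Sx]]] := branch_residue k3 ws es is_ inc hds.
have [|t0 [s1 /= [[h1 h2 d0 i0] [r0 p0 w0]]]] := @tallest_child _ e k t.
  by case: Sx => [[_ ?]|[_ ? _]]; lia.
have [it0 is1 inc1] := i0 it; have /and3P[wt0 ws1] := w0 wt; rewrite r0 => es1.
have hd1 : dia s1 <= 2 * k by clear -hdt d0; lia.
have [S1 [x1 [S1cov S1dom S1x]]] := branch_residue k3 ws1 es1 is1 inc1 hd1.
have m0 : tsize t = tsize t0 + tsize s1 by rewrite /tsize (perm_size p0) size_cat.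
have ms := branch_tsize is_ inc hds; have ms1 := branch_tsize is1 inc1 hd1.
have hs := ht_le_dia s; have hs1 := ht_le_dia s1.
pose B := [seq y <- labels s ++ labels s1 | y \in ball e k (troot t)].
apply: nred; exists t0, (B ++ (S ++ S1)), (k + (x + x1)); split=> //.
- move=> y; rewrite !mem_cat mem_filter mem_cat (perm_mem p0) mem_cat -orbA.
  case/or3P=> [->//|ys|ys]; rewrite ys ?orbT andbT.
    by have [|->|->] := S1cov y; rewrite ?orbT.
  by have [|->|->] := Scov y; rewrite ?orbT.
- by rewrite tsize_Graft m0 -addnA -[ltnLHS]addn0 ltn_add2l addn_gt0 tsize_gt0.
- apply: dominable_cat (dominable_cat Sdom S1dom).
  apply: (@dominable_ball (troot t)); first by clear -k3; lia.
  by move=> y; rewrite mem_filter => /andP[].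
rewrite tsize_Graft m0 -addnA addKn.
(* By [hts] the two heights sum to at least [2k - 1], so some branch has height [k] and order 7 or
   10; the other is of the same kind or has height [k - 1] and [2m > 3(k - 1)]. *)
clear -Sx S1x k3 hts h1 ms ms1 hs hs1; move: Sx S1x; rewrite !inE !xpair_eqE.
case=> [[-> ?]|[-> ? /orP[]/andP[/eqP ? /eqP ?]]];
  case=> [[-> ?]|[-> ? /orP[]/andP[/eqP ? /eqP ?]]]; subst; try lia.
Qed.

Definition cost_bound n := ceil_div ((k + 2) * n) (3 * (k + 1)).

Lemma dominable_tree t :
  2 < k -> wf e t -> dominable (labels t) (cost_bound (tsize t)).
Proof.
move=> k3; move En : (tsize t) => n; elim/ltn_ind: n t En => n IHn t En wt.
apply: contraT => ndom.
have nred : ~ reducible t.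
  move=> [t' [S [j [[wt' _] sub lt dom cost]]]]; case/negP: ndom.
  have dom' : dominable (labels t') (cost_bound (tsize t')) by apply: IHn => //; lia.
  apply: dominable_sub sub _ (dominable_cat dom' dom).
  (* The [j] units enter the numerator, where the removed vertices outweigh them. *)
  rewrite /cost_bound /ceil_div -divnDMl; last by lia.
  by apply: leq_div2r; nia.
have hd := not_reducible_dia k3 wt nred.
have it := not_reducible_irreducible wt nred.
have mt := irreducible_tsize_dia it hd; have m0 := tsize_gt0 t.
(* A single vertex has diameter 0 but still needs radius 1. *)
pose R := maxn 1 (uphalf (dia t)).
have hR : dia t <= 2 * R by lia.
have [w _ cov] := center_exists e_sym wt hR.
case/negP: ndom; apply: dominable_sub (dominable_ball _ cov) => //; last by lia.
(* The possible deficit of 2 is absorbed by rounding up. *)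
have mR : 3 * R <= n + 2 by lia.
rewrite /cost_bound /ceil_div leq_divRL; last by lia.
nia.
Qed.

End Broadcasts.

(** * Spanning trees of connected graphs *)

Section SpanningTree.
Variables (T : finType) (e : rel T).
Hypotheses (e_sym : symmetric e) (e_conn : connected_graph e).

Lemma graft_vertex t x y :
    wf e t -> x \in labels t -> e x y ->
  exists t', [/\ wf e t', troot t' = troot t & perm_eq (labels t') (y :: labels t)].
Proof.
move=> wt + exy; elim: t wt => [z|t IHt s IHs] /=.
  move=> _; rewrite inE => /eqP <-; exists (Graft (One x) (One y)).
  by split=> //=; rewrite ?exy // (perm_catC [:: x] [:: y]).
case/and3P=> wt ws es; rewrite mem_cat => /orP[/(IHt wt)|/(IHs ws)] [t' [wt' r' p']].
  exists (Graft t' s); split=> //=; first by rewrite wt' ws r' es.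
  by rewrite -cat_cons perm_cat2r.
exists (Graft t t'); split=> //=; first by rewrite wt wt' r' es.
by rewrite perm_catC -cat1s perm_sym perm_catCA perm_sym perm_catC perm_cat2l.
Qed.

Lemma spanning_tree (r : T) :
  exists t, [/\ wf e t, tsize t = #|T| & {subset enum T <= labels t}].
Proof.
have grow n : n < #|T| -> exists t, [/\ wf e t, tsize t = n.+1 & uniq (labels t)].
  elim: n => [|n IHn] nT; first by exists (One r).
  have [t [wt mt ut]] := IHn (ltnW nT).
  have [x [y [xt yt exy]]] : exists x y, [/\ x \in labels t, y \notin labels t & e x y].
    have [/existsP[x /existsP[y /and3P[]]]|nex] :=
      boolP [exists x, exists y, [&& x \in labels t, y \notin labels t & e x y]].
      by exists x, y.
    (* With no edge leaving it, the label set is a union of components, hence everything. *)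
    have cl : closed e (mem (labels t)).
      apply: intro_closed; first by apply: sym_connect_sym.
      move=> x y exy xt; apply: contraNT nex => yt.
      by apply/existsP; exists x; apply/existsP; exists y; rewrite xt yt.
    have /card_uniqP := ut; rewrite -/(tsize t) mt => cardt.
    have rt : troot t \in labels t.
      by elim: (t) => [z|t1 IH1 s1 _] /=; rewrite ?inE // mem_cat IH1.
    have : #|T| <= #|labels t|.
      apply: subset_leq_card; apply/subsetP => z _.
      by have := closed_connect cl (e_conn (troot t) z); rewrite rt => <-.
    by rewrite cardt leqNgt nT.
  have [t' [wt' _ p']] := graft_vertex wt xt exy.
  exists t'; split=> //; first by rewrite /tsize (perm_size p') /= -mt.
  by rewrite (perm_uniq p') /= yt.
have [|t [wt mt ut]] := grow #|T|.-1.
  by rewrite prednK //; apply/card_gt0P; exists r.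
have T0 : 0 < #|T| by apply/card_gt0P; exists r.
rewrite prednK // in mt; exists t; split=> // x _.
have sz : size (enum T) <= size (labels t) by rewrite -cardE -mt.
by have [_ ->] := uniq_min_size ut (fun z _ => mem_enum T z) sz; rewrite mem_enum.
Qed.

End SpanningTree.

Theorem theorem3 (T : finType) (e : rel T) (k : nat) :
  is_tree e -> 3 <= k -> k < rad e ->
  gammaB e k <= ceil_div ((k + 2) * #|T|) (3 * (k + 1)).
Proof.
move=> [[e_sym _] [e_conn _]] k3 _; apply: gammaB_dominable.
(* An [rtree] is never empty, so the empty graph is treated apart. *)
have [r _|T0] := pickP (@predT T); last first.
  apply: (@dominable_sub _ _ _ _ [::] _ 0) => //.
  - by move=> x; have := T0 x.
  - by apply/existsP; exists [ffun=> ord0]; rewrite /= andbT /bcost big1 // => x; have := T0 x.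
have [t [wt mt sub]] := spanning_tree e_sym e_conn r.
by rewrite -mt; apply: dominable_sub sub _ (dominable_tree e_sym k3 wt).
Qed.
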